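(* There is a constant $C>0$ such that for all positive integers $k$ and $d$ with $d\le 2^k$ there exist a set $X$ with $|X|=d$, a probability $p_0\in\Delta(X)$, and a martingale $p_0^k\in\mathcal{M}_k(X,p_0)$ such that $$V(p_0^k)\ge C\sqrt{k\log d}.$$
   Context: $\log$ is the natural logarithm. For a finite set $X$, $\Delta(X)$ is the set of $p\in\mathbb{R}^X$ with $p(x)\ge0$ for all $x$ and $\sum_{x\in X}p(x)=1$, and $\|q\|_1=\sum_{x\in X}|q(x)|$ for $q\in\mathbb{R}^X$. For $p\in\Delta(X)$ and a positive integer $k$, $\mathcal{M}_k(X,p)$ denotes the set of all martingales $p_0^k=p_0,\ldots,p_k$ (stochastic processes on some probability space with $E(p_t\mid p_0,\ldots,p_{t-1})=p_{t-1}$ for $1\le t\le k$) such that $p_t\in\Delta(X)$ for all $0\le t\le k$ and $p_0=p$ (constant). The variation of $p_0^k$ is $V(p_0^k)=E\left(\sum_{t=1}^k\|p_t-p_{t-1}\|_1\right)$. *)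

(* Defs.v *)
From HB Require Import structures.
From mathcomp Require Import all_boot all_order all_algebra.
From mathcomp Require Import all_classical all_reals all_analysis.

Set Implicit Arguments.
Unset Strict Implicit.
Unset Printing Implicit Defensive.

Import Order.TTheory GRing.Theory Num.Theory.
Import numFieldNormedType.Exports.

Local Open Scope classical_set_scope.
Local Open Scope ring_scope.

Definition simplex (R : realType) (X : finType) : set (X -> R) :=
  [set p | (forall x, 0 <= p x) /\ \sum_(x : X) p x = 1].

Definition norm1 (R : realType) (X : finType) (q : X -> R) : R :=
  \sum_(x : X) `|q x|.

(* [Z] is a version of E(Y | G); it is meant for [G] a sub-sigma-algebra of
   the measurable sets. The inclusion says that [Z] is G-measurable. *)
Definition is_cond_exp (disp : measure_display) (T : measurableType disp)
    (R : realType) (P : probability T R) (G : set_system T) (Y Z : T -> R) :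
    Prop :=
  [/\ P.-integrable setT (EFin \o Y), P.-integrable setT (EFin \o Z),
      preimage_set_system setT Z measurable `<=` G
    & forall A, G A ->
        (\int[P]_(w in A) (Y w)%:E = \int[P]_(w in A) (Z w)%:E)%E].

(* The sigma-algebra generated by p_0, ..., p_(t-1), where [p s w x] is the
   coordinate x of p_s at the sample point w. Since X is finite, a vector
   generates the same sigma-algebra as its coordinates. *)
Definition history (disp : measure_display) (T : measurableType disp)
    (R : realType) (X : finType) (p : nat -> T -> X -> R) (t : nat) :
    set_system T :=
  <<s \bigcup_(s in [set s | (s < t)%N]) \bigcup_(x in [set: X])
        preimage_set_system setT (fun w => p s w x) measurable >>.

(* Only the values [p t] with t <= k matter: the process is p_0, ..., p_k. *)
Definition simplex_martingale (disp : measure_display) (T : measurableType disp)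
    (R : realType) (P : probability T R) (X : finType) (k : nat)
    (p0 : X -> R) (p : nat -> T -> X -> R) : Prop :=
  [/\ forall t x, (t <= k)%N -> measurable_fun setT (fun w => p t w x),
      forall t w, (t <= k)%N -> simplex (p t w),
      forall w, p 0%N w = p0
    & forall t x, (1 <= t <= k)%N ->
        is_cond_exp P (history p t) (fun w => p t w x)
          (fun w => p t.-1 w x)].

Definition martingale_variation (disp : measure_display) (T : measurableType disp)
    (R : realType) (P : probability T R) (X : finType) (k : nat)
    (p : nat -> T -> X -> R) : \bar R :=
  'E_P[fun w => \sum_(1 <= t < k.+1) norm1 (fun x => p t w x - p t.-1 w x)].

(* Main.v *)
Require Import Defs.
From HB Require Import structures.
From mathcomp Require Import all_boot all_order all_algebra.
From mathcomp Require Import all_classical all_reals all_analysis.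
From mathcomp Require Import measurable_realfun ring lra.

Set Implicit Arguments.
Unset Strict Implicit.
Unset Printing Implicit Defensive.

Import Order.TTheory GRing.Theory Num.Theory.
Import numFieldNormedType.Exports.

Local Open Scope classical_set_scope.
Local Open Scope ring_scope.

(** The martingale is a random product of Bernoulli laws on the cube
[{0,1}^n], where [2^n <= d < 2^(n+1)]; the [d - 2^n] remaining points of [X]
carry no mass. Every parameter starts at [1/2]. Time is cut into [n] blocks of
length about [m = k / n], and in block [i] only the parameter of coordinate
[i] moves.

In a product law, changing one parameter from [q] to [q'] moves the law by
[2 * |q' - q|] in the l1 norm, because the other factors integrate to [1]
([norm1_product_weightB]). So the variation is the sum over the [n] blocks of
the variations of [n] martingales on two points, and it is enough that each of
them has variation of order [sqrt m]: the total is then of order [n * sqrt m],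
about [sqrt (k * n)], hence of order [sqrt (k * log d)].

A parameter moves by [q -> q +- a * q * (1 - q)], the sign being a fair coin
and [a = 1 / sqrt m]. The factor [q * (1 - q)] keeps [q] in [[0, 1]] with no
stopping time. It also makes the expected size of a step computable: a step
lowers the expectation of [q * (1 - q)] by
[a^2 * E (q^2 * (1 - q)^2) <= a^2 / 16]. As [q * (1 - q)] starts at [1/4] and the block has [m = 1 / a^2] steps,
its expectation stays above [1/4 - 1/16 = 3/16] ([sum_spread_active_ge]), and
each of the [k] steps contributes at least [2 * a * 3/16] to the variation.

The sample space is [{0,1}^k] with the uniform probability, so every
expectation is a finite sum. Conditional expectations reduce to a symmetry:
flipping coin [s] preserves the probability and every event of the past of
time [s + 1], and the values of the process at time [s + 1] before and after
the flip average to the value at time [s] ([history_flip], [process_mid]). *)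

(** * The space of fair coin tosses *)

Definition coins (k : nat) : predArgType := {ffun 'I_k -> bool}.

HB.instance Definition _ k := Finite.on (coins k).
HB.instance Definition _ k := isPointed.Build (coins k) [ffun=> false].
HB.instance Definition _ k :=
  @isMeasurable.Build default_measure_display (coins k)
    discrete_measurable discrete_measurable0
    discrete_measurableC discrete_measurableU.

Section fair_coins.
Context (R : realType) (k : nat).
Local Notation N := #|coins k|.

Lemma card_coins : N = (2 ^ k)%N.
Proof. by rewrite card_ffun card_bool card_ord. Qed.

Definition fair_coins : set (coins k) -> \bar R :=
  mscale ((2 ^+ k)^-1%R%:nng : {nonneg R})
    (msum (fun i => \d_(nth point (enum (coins k)) i)) N).

HB.instance Definition _ := Measure.on fair_coins.

Lemma sum_enum_coins (V : nmodType) (F : coins k -> V) :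
  (\sum_(i < N) F (nth point (enum (coins k)) i) = \sum_w F w)%R.
Proof.
rewrite [RHS](reindex _ (onW_bij _ (@enum_val_bij (coins k)))) /=.
by apply: eq_bigr => i _; rewrite (enum_val_nth (point : coins k)).
Qed.

Lemma integral_fair_coins (A : set (coins k)) (f : coins k -> R) :
  (forall w, 0 <= f w) ->
  (\int[fair_coins]_(w in A) (f w)%:E
    = ((2 ^+ k)^-1 * \sum_w (w \in A)%:R * f w)%:E)%E.
Proof.
move=> f0.
have mf : measurable_fun A (EFin \o f) by [].
rewrite ge0_integral_mscale//; last by move=> w _; rewrite lee_fin.
rewrite ge0_integral_measure_sum//; last by move=> w _; rewrite lee_fin.
rewrite EFinM; congr (_ * _)%E.
under eq_bigr do rewrite integral_dirac// diracE -EFinM.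
by rewrite sumEFin (sum_enum_coins (fun w => (w \in A)%:R * f w)).
Qed.

Lemma fair_coins_setT : fair_coins setT = 1%E.
Proof.
rewrite -[LHS]mul1e -(integral_cst fair_coins measurableT 1) /cst.
rewrite (@integral_fair_coins setT (fun=> 1)) //.
under eq_bigr do rewrite in_setT mul1r.
by rewrite sumr_const card_coins natrX mulVf ?expf_neq0 ?pnatr_eq0.
Qed.
HB.instance Definition _ :=
  @Measure_isProbability.Build _ _ R fair_coins fair_coins_setT.

(** Tosses are indexed by [nat] so that the recursion on time below needs no
bound on it; the value [false] past the last toss is a dummy. *)
Definition heads (w : coins k) (s : nat) : bool := oapp w false (insub s).

Definition flip (s : nat) (w : coins k) : coins k :=
  [ffun i => w i (+) (i == s :> nat)].

Lemma heads_flip s w r : (r < k)%N ->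
  heads (flip s w) r = heads w r (+) (r == s).
Proof. by move=> rk; rewrite /heads insubT /= ffunE. Qed.

Lemma flipK s : involutive (flip s).
Proof. by move=> w; apply/ffunP => i; rewrite !ffunE -addbA addbb addbF. Qed.

Lemma sum_flip (V : nmodType) s (F : coins k -> V) :
  \sum_w F (flip s w) = \sum_w F w.
Proof. by rewrite [RHS](reindex_inj (can_inj (flipK s))). Qed.

End fair_coins.

(** * Product laws on the cube *)

Section weights.
Context (R : realType) (n e : nat).
Local Notation state := ({ffun 'I_n -> bool} + 'I_e)%type.
Implicit Types q u v : 'I_n -> R.

Definition bernoulli_weight (q : R) (b : bool) : R := if b then q else 1 - q.

(** The points of ['I_e] only pad the cube to the required cardinality. *)
Definition product_weight (q : 'I_n -> R) (x : state) : R :=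
  if x is inl f then \prod_i bernoulli_weight (q i) (f i) else 0.

Lemma product_weight_simplex q : (forall i, 0 <= q i <= 1) ->
  simplex (product_weight q).
Proof.
move=> q01; split=> [[f|//]|].
  apply: prodr_ge0 => i _; have := q01 i; rewrite /bernoulli_weight.
  by case: (f i); lra.
rewrite big_sumType /= [X in _ + X]big1 // addr0.
rewrite -(bigA_distr_bigA (fun i b => bernoulli_weight (q i) b)).
by apply: big1 => i _; rewrite big_bool /bernoulli_weight /= subrKC.
Qed.

(** The product weight is affine in each parameter. *)
Lemma product_weight_mid (j : 'I_n) u v q :
    (forall i, i != j -> u i = q i /\ v i = q i) -> u j + v j = 2 * q j ->
  forall x, product_weight u x + product_weight v x = 2 * product_weight q x.
Proof.
move=> uvq mid [f|b] /=; last by rewrite mulr0 addr0.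
have rest (r : 'I_n -> R) : (forall i, i != j -> r i = q i) ->
    \prod_i bernoulli_weight (r i) (f i) = bernoulli_weight (r j) (f j) *
      \prod_(i | i != j) bernoulli_weight (q i) (f i).
  by move=> rq; rewrite (bigD1 j) //=; congr (_ * _); apply: eq_bigr => i /rq ->.
rewrite (rest u) ?(rest v) ?(rest q) //; try by move=> i /uvq[].
rewrite -mulrDl mulrA; congr (_ * _).
by rewrite /bernoulli_weight; case: (f j); lra.
Qed.

(** The difference of the two laws is again a product: its factor at [j] is
[+-(v j - u j)], of l1 norm [2 * `|v j - u j|], and every other factor has l1
norm [1]. *)
Lemma norm1_product_weightB (j : 'I_n) u v :
    (forall i, 0 <= u i <= 1) -> (forall i, i != j -> v i = u i) ->
  norm1 (fun x => product_weight v x - product_weight u x) = 2 * `|v j - u j|.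
Proof.
move=> u01 vu; rewrite /norm1 big_sumType /= [X in _ + X]big1 ?addr0; last first.
  by move=> b _; rewrite subrr normr0.
pose g i b : R := if i == j then `|v j - u j| else bernoulli_weight (u i) b.
rewrite (eq_bigr (fun f : {ffun 'I_n -> bool} => \prod_i g i (f i))); last first.
  move=> f _; rewrite (bigD1 j) // [X in _ - X](bigD1 j) // [RHS](bigD1 j) //=.
  rewrite (eq_bigr (fun i => bernoulli_weight (u i) (f i))); last first.
    by move=> i /vu ->.
  rewrite -mulrBl normrM /g eqxx; congr (_ * _).
    rewrite /bernoulli_weight; case: (f j) => //.
    by rewrite -normrN; congr `|_|; lra.
  rewrite ger0_norm; last first.
    apply: prodr_ge0 => i _; have := u01 i; rewrite /bernoulli_weight.
    by case: (f i); lra.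
  by apply: eq_bigr => i /negPf ->.
rewrite -(bigA_distr_bigA g) (bigD1 j) //= [X in _ * X]big1 ?mulr1.
  by rewrite big_bool /g /= !eqxx mulr_natl mulr2n.
move=> i /negPf ij.
by rewrite big_bool /g ij /bernoulli_weight /= subrKC.
Qed.

End weights.

(** * The random walk of the parameters *)

Section bias.
Context (R : realType) (m : nat) (a : R).

(** The step size vanishes at [0] and [1] like the distance to these points,
which confines the walk to the unit interval without stopping it. *)
Definition nudge (b : bool) (q : R) : R :=
  q + (if b then a else - a) * (q * (1 - q)).

(** The toss of time [s] moves the parameter of coordinate [s %/ m], so
coordinate [i] is active exactly during the times
[i * m, ..., i * m + m - 1]. *)
Fixpoint bias (c : nat -> bool) (t i : nat) : R :=
  if t is s.+1 then
    if i == (s %/ m)%N then nudge (c s) (bias c s i) else bias c s i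
  else 2^-1.

Lemma nudge_itv b q : 0 <= a <= 1 -> 0 <= q <= 1 -> 0 <= nudge b q <= 1.
Proof.
move=> /andP[a0 a1] /andP[q0 q1].
have v0 : 0 <= q * (1 - q) by rewrite mulr_ge0 // subr_ge0.
have av0 : 0 <= a * (q * (1 - q)) by rewrite mulr_ge0.
have av1 : a * (q * (1 - q)) <= q * (1 - q) by rewrite ler_piMl.
have vq : q * (1 - q) <= q by rewrite ler_piMr // lerBlDr lerDl.
have vq' : q * (1 - q) <= 1 - q by rewrite ler_piMl // subr_ge0.
by rewrite /nudge; case: b => /=; lra.
Qed.

Lemma bias_itv c t i : 0 <= a <= 1 -> 0 <= bias c t i <= 1.
Proof.
move=> a01; elim: t => [|s IHs] /=; first by lra.
by case: ifP => _ //; exact: nudge_itv.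
Qed.

Lemma eq_bias c c' t : (forall s, (s < t)%N -> c s = c' s) ->
  bias c t =1 bias c' t.
Proof.
elim: t => [//|t IHt] cc' i /=; rewrite IHt ?cc' // => s st.
by apply: cc'; rewrite ltnS ltnW.
Qed.

Context (k : nat).

Lemma bias_flip (w : coins k) s t : (t <= s)%N -> (t <= k)%N ->
  bias (heads (flip s w)) t =1 bias (heads w) t.
Proof.
move=> ts tk; apply: eq_bias => r rt.
by rewrite heads_flip ?(leq_trans rt) // ltn_eqF ?addbF // (leq_trans rt).
Qed.

(** The variance of the Bernoulli law of coordinate [i]; up to the factor [a]
it is also the length of its next step when the coordinate is active. *)
Definition spread t i (w : coins k) : R :=
  let q := bias (heads w) t i in q * (1 - q).

(** With [v = q * (1 - q)], the values of [v] after the two possible steps are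
[v +- a * v * (1 - 2 * q) - a ^+ 2 * v ^+ 2], whose mean is
[v - a ^+ 2 * v ^+ 2]. The two outcomes are paired by flipping toss [t]. *)
Lemma sum_spreadS t i : (t < k)%N ->
  \sum_w spread t.+1 i w =
  \sum_w (spread t i w - (i == (t %/ m)%N)%:R * a ^+ 2 * spread t i w ^+ 2).
Proof.
move=> tk; apply: (@mulfI _ 2%:R); first by rewrite pnatr_eq0.
rewrite mulr_natl mulr2n -{1}(sum_flip t) -big_split /= mulr_sumr.
apply: eq_bigr => w _; rewrite /spread /= heads_flip // eqxx addbT.
rewrite bias_flip // 1?ltnW //; case: eqP => _ /=; last by ring.
by rewrite /nudge; case: (heads w t) => /=; ring.
Qed.


(** [t - i * m] bounds the number of steps that coordinate [i] has made; each
costs at most [a ^+ 2 / 16] since [q * (1 - q) <= 1/4]. The truncated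
subtraction is what leaves the bound at [1/4] until block [i] starts. *)
Lemma sum_spread_ge t i : 0 <= a <= 1 -> (t <= k)%N ->
  2 ^+ k * (4^-1 - (t - i * m)%:R * a ^+ 2 / 16) <= \sum_w spread t i w.
Proof.
move=> a01; have cst (x : R) : \sum_(w : coins k) x = 2 ^+ k * x.
  by rewrite sumr_const card_coins -[LHS]mulr_natl natrX.
elim: t => [|t IHt] tk.
  by rewrite sub0n !mul0r subr0 -cst ler_sum // => w _; rewrite /spread /=; lra.
rewrite sum_spreadS // sumrB lerBrDr.
apply: le_trans (IHt (ltnW tk)).
have bnd : \sum_w (i == (t %/ m)%N)%:R * a ^+ 2 * spread t i w ^+ 2 <=
    2 ^+ k * ((i == (t %/ m)%N)%:R * a ^+ 2 / 16).
  rewrite -cst; apply: ler_sum => w _; apply: ler_wpM2l.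
    by rewrite mulr_ge0 ?sqr_ge0.
  have := bias_itv (heads w) t i a01; rewrite /spread.
  move: (bias _ _ _) => q /andP[q0 q1].
  have v0 : 0 <= q * (1 - q) by rewrite mulr_ge0 // subr_ge0.
  have := sqr_ge0 (q - 2^-1); rewrite expr2; nra.
apply: le_trans (lerD (lexx _) bnd) _; rewrite -mulrDr ler_wpM2l ?exprn_ge0 //.
have : (t - i * m)%:R + (i == (t %/ m)%N)%:R <= (t.+1 - i * m)%:R :> R.
  rewrite -natrD ler_nat; case: eqP => [->|_]; last by rewrite addn0 leq_sub2r.
  by rewrite addn1 subSn // leq_trunc_div.
have := sqr_ge0 a; nra.
Qed.

Lemma sum_spread_active_ge t : m%:R * a ^+ 2 = 1 -> 0 <= a <= 1 -> (t <= k)%N ->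
  2 ^+ k * (3 / 16) <= \sum_w spread t (t %/ m) w.
Proof.
move=> ma a01 tk; apply: le_trans (sum_spread_ge _ a01 tk).
have m0 : (0 < m)%N by rewrite lt0n; apply/eqP => m0; move: ma; rewrite m0; lra.
rewrite ler_wpM2l ?exprn_ge0 //.
have : (t - t %/ m * m)%:R <= m%:R :> R.
  by rewrite ler_nat {1}(divn_eq t m) addKn ltnW // ltn_mod.
have := sqr_ge0 a; nra.
Qed.

End bias.

(** * The martingale *)

Section process.
Context (R : realType) (k n e m : nat) (a : R).
Hypothesis a01 : 0 <= a <= 1.
Local Notation state := ({ffun 'I_n -> bool} + 'I_e)%type.

Definition process (t : nat) (w : coins k) : state -> R :=
  product_weight (fun i : 'I_n => bias m a (heads w) t i).

Lemma process_simplex t w : simplex (process t w).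
Proof. by apply: product_weight_simplex => i; exact: bias_itv. Qed.

Lemma process_flip s t w : (t <= s)%N -> (t <= k)%N ->
  process t (flip s w) = process t w.
Proof.
move=> ts tk; rewrite /process; congr product_weight.
by apply/funext => i; rewrite bias_flip.
Qed.

(** From time [s] to [s + 1] toss [s] moves the parameter of a single
coordinate, and its two possible new values average to the old one. *)
Lemma process_mid s w x : (s < k)%N ->
  process s.+1 w x + process s.+1 (flip s w) x = 2 * process s w x.
Proof.
move=> sk; have [sn|ns] := ltnP (s %/ m) n.
  apply: (product_weight_mid (j := Ordinal sn)) => [i|] /=.
    by move=> /negPf; rewrite -val_eqE /= => ->; rewrite bias_flip // ltnW.
  rewrite eqxx heads_flip // eqxx addbT bias_flip ?(ltnW sk) //.
  by rewrite /nudge; case: (heads w s) => /=; ring.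
(* After the last block the process is constant. *)
have idle w' : process s.+1 w' = process s w'.
  rewrite /process; congr product_weight; apply/funext => i /=.
  by rewrite ltn_eqF // (leq_trans _ ns).
by rewrite !idle process_flip // ?(ltnW sk) //; ring.
Qed.

Lemma norm1_processB s w : (s < k)%N -> (s %/ m < n)%N ->
  norm1 (fun x => process s.+1 w x - process s w x)
    = 2 * a * spread m a s (s %/ m) w.
Proof.
move=> sk sn; rewrite (@norm1_product_weightB _ _ _ (Ordinal sn)) /=.
- rewrite eqxx /nudge /spread; have := bias_itv m (heads w) s (s %/ m) a01.
  move: (bias _ _ _ _ _) => q q01; rewrite addrC addKr normrM.
  have -> : `|if heads w s then a else - a| = a.
    by case: ifP => _; rewrite ?normrN ger0_norm //; case/andP: a01.
  by rewrite ger0_norm ?mulrA //; nra.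
- by move=> i; exact: bias_itv.
- by move=> i /negPf; rewrite -val_eqE /= => ->.
Qed.

(** The first [s + 1] positions of the process ignore toss [s], and the events
invariant under flipping it form a sigma-algebra. *)
Lemma history_flip s A : (s < k)%N -> history process s.+1 A ->
  forall w, (flip s w \in A) = (w \in A).
Proof.
move=> sk; rewrite /history => hA.
suff inv w : A (flip s w) <-> A w.
  by move=> w; apply/idP/idP; rewrite !inE => /inv.
move: A hA w; apply: smallest_sub; first split.
- by [].
- by move=> A hA w; rewrite setTD; split=> nA /hA.
- move=> F hF w; split=> -[i _ /hF FF]; exists i => //.
- move=> _ [r rs [x _ [B _ <-]]] w /=.
  have {}rs : (r <= s)%N by exact: rs.
  by rewrite process_flip // (leq_trans rs) // ltnW.
Qed.

Lemma process_martingale w0 :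
  simplex_martingale (@fair_coins R k) k (process 0 w0) process.
Proof.
have p_ge0 t x w : 0 <= process t w x by have [] := process_simplex t w.
have p_int t x : (@fair_coins R k).-integrable setT
    (EFin \o (fun w => process t w x)).
  apply/integrableP; split=> //.
  under eq_integral do rewrite /= ger0_norm ?p_ge0 //.
  by rewrite integral_fair_coins // ltry.
split=> //.
- by move=> t w _; exact: process_simplex.
move=> [//|s] x sk; split=> //.
  rewrite /history => A hA; apply: sub_sigma_algebra.
  by exists s; [exact: ltnSn|exists x].
move=> A hA; rewrite !integral_fair_coins //; congr (_ * _)%:E.
(* Over [A], pair each outcome with the one where toss [s] is flipped. *)
apply: (@mulfI _ 2%:R); first by rewrite pnatr_eq0.
rewrite mulr_natl mulr2n -{1}(sum_flip s) -big_split /= mulr_sumr.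
apply: eq_bigr => w _; rewrite (history_flip sk hA) -mulrDr mulrCA.
by congr (_ * _); rewrite addrC process_mid.
Qed.

Lemma process_variation_ge : m%:R * a ^+ 2 = 1 -> (k <= n * m)%N ->
  ((k%:R * (2 * a * (3 / 16)))%:E
     <= martingale_variation (@fair_coins R k) k process)%E.
Proof.
move=> ma knm; rewrite /martingale_variation unlock integral_fair_coins; last first.
  by move=> w; apply: sumr_ge0 => t _; apply: sumr_ge0.
rewrite lee_fin ler_pdivlMl ?exprn_gt0 //.
under eq_bigr do rewrite in_setT mul1r.
rewrite exchange_big /= big_add1 /= big_mkord.
have -> : 2 ^+ k * (k%:R * (2 * a * (3 / 16)))
    = \sum_(s < k) 2 * a * (2 ^+ k * (3 / 16)).
  by rewrite sumr_const card_ord -mulr_natl; ring.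
apply: ler_sum => s _.
have m0 : (0 < m)%N by rewrite lt0n; apply/eqP => m0; move: ma; rewrite m0; lra.
have sn : (s %/ m < n)%N by rewrite ltn_divLR // (leq_trans _ knm).
under eq_bigr do rewrite norm1_processB //.
have a2 : 0 <= 2 * a by case/andP: a01 => a0 _; rewrite mulr_ge0.
rewrite -mulr_sumr ler_wpM2l //.
by rewrite sum_spread_active_ge // ltnW.
Qed.

End process.

(** * The choice of the parameters *)

Lemma exists_inv_sqrt (R : realType) m : (0 < m)%N ->
  exists2 a : R, 0 <= a <= 1 & m%:R * a ^+ 2 = 1.
Proof.
move=> m0; exists (Num.sqrt m%:R)^-1.
  rewrite invr_ge0 sqrtr_ge0 /= invf_le1 ?sqrtr_gt0 ?ltr0n //.
  by rewrite -{1}sqrtr1 ler_wsqrtr ?ler1n.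
by rewrite exprVn sqr_sqrtr ?ler0n // mulfV // pnatr_eq0 -lt0n.
Qed.

Lemma ln_nat_le (R : realType) (n d : nat) : (0 < d)%N -> (d <= 2 ^ n)%N ->
  ln d%:R <= n%:R :> R.
Proof.
move=> d0 dn.
have ln2 : ln 2%:R <= 1 :> R.
  by have := @le_ln1Dx R 1; rewrite -natr1; apply; lra.
apply: (@le_trans _ _ (ln (2%:R ^+ n))).
  by rewrite ler_ln ?posrE ?exprn_gt0 ?ltr0n // -natrX ler_nat.
by rewrite lnXn ?ltr0n // -[leLHS]mulr_natl ler_piMr.
Qed.

Theorem theorem2 (R : realType) :
  exists C : R, 0 < C /\
    forall k d : nat, (0 < k)%N -> (0 < d)%N -> (d <= 2 ^ k)%N ->
      exists (X : finType) (p0 : X -> R),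
        [/\ #|X| = d, simplex p0
          & exists (disp : measure_display) (T : measurableType disp)
              (P : probability T R) (p : nat -> T -> X -> R),
              simplex_martingale P k p0 p /\
              ((C * Num.sqrt (k%:R * ln d%:R))%:E <= martingale_variation P k p)%E].
Proof.
exists (3 / 16); split=> [|k d k0 d0 dk]; first by lra.
pose n := trunc_log 2 d; pose m := (k %/ n).+1.
have [ld ud] : (2 ^ n <= d)%N /\ (d < 2 ^ n.+1)%N.
  by have /andP[] := trunc_log_bounds (isT : (1 < 2)%N) d0.
have nk : (n <= k)%N.
  by rewrite -(@leq_exp2l 2) // (leq_trans ld).
have [a a01 ma] := exists_inv_sqrt R (isT : (0 < m)%N).
pose p := @process R k n (d - 2 ^ n) m a.
exists ({ffun 'I_n -> bool} + 'I_(d - 2 ^ n))%type, (p 0 point); split.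
- by rewrite card_sum card_ffun card_bool !card_ord subnKC.
- exact: process_simplex.
exists default_measure_display, (coins k), (@fair_coins R k), p.
split; first exact: process_martingale.
(* For [d = 1] there is no coordinate to move, and the bound is [0]. *)
have [n0|n0] := posnP n.
  have d1 : d = 1%N by move: ud; rewrite n0; case: (d) d0 => [|[|]].
  have -> : ln d%:R = 0 :> R by rewrite d1 ln1.
  rewrite mulr0 sqrtr0 mulr0 /martingale_variation unlock.
  apply: integral_ge0 => w _; rewrite lee_fin.
  by apply: sumr_ge0 => t _; apply: sumr_ge0.
have knm : (k <= n * m)%N by rewrite mulnC ltnW // ltn_ceil.
apply: le_trans (process_variation_ge _ a01 ma knm).
rewrite lee_fin.
have Lm : ln d%:R * m%:R <= 4 * k%:R :> R.
  have L2n : ln d%:R <= (2 * n)%:R :> R.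
    apply: ln_nat_le => //; apply: leq_trans (ltnW ud) _.
    by rewrite leq_exp2l // mul2n -addnn -addn1 leq_add2l.
  apply: le_trans (ler_wpM2r _ L2n) _ => //; rewrite -!natrM ler_nat.
  (* Here [n * m <= 2 * k], because [n <= k] and [m = k %/ n + 1]. *)
  rewrite -mulnA -[4%N]/(2 * 2)%N -mulnA leq_pmul2l //.
  rewrite mulnS mulnC mul2n -addnn addnC.
  by rewrite leq_add // leq_trunc_div.
have -> : k%:R * (2 * a * (3 / 16)) = 3 / 16 * (2 * a * k%:R) :> R by ring.
rewrite ler_wpM2l //.
rewrite -[leRHS]ger0_norm -?sqrtr_sqr; last by rewrite mulr_ge0 ?ler0n //; lra.
rewrite ler_wsqrtr //.
have -> : (2 * a * k%:R) ^+ 2 = k%:R * (4 * k%:R * a ^+ 2) :> R by ring.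
rewrite ler_wpM2l //.
have -> : ln d%:R = ln d%:R * m%:R * a ^+ 2 :> R by rewrite -mulrA ma mulr1.
by rewrite ler_wpM2r ?sqr_ge0.
Qed.
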